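(* Let $T:\mathcal{M}_d\to\mathcal{M}_d$ be a doubly stochastic quantum channel such that $T^*T$ is primitive. Then $\|T\|_{2\to q,\frac{\mathbb{1}_d}{d}}\leq1$ for all $q\leq 2+2\alpha_D(T)$.
   Context: Doubly stochastic channel: completely positive, trace preserving, $T(\mathbb{1})=T^*(\mathbb{1})=\mathbb{1}$. A doubly stochastic channel $S$ is primitive if $S^k(\rho)\to\mathbb{1}_d/d$ for all states. Weighted norm $\|Y\|_{p,\frac{\mathbb{1}_d}{d}}=d^{-1/p}(\text{tr}|Y|^p)^{1/p}$ and $\|T\|_{2\to q,\frac{\mathbb{1}_d}{d}}=\sup_{X\neq0}\|T(X)\|_{q,\frac{\mathbb{1}_d}{d}}/\|X\|_{2,\frac{\mathbb{1}_d}{d}}$. Discrete LS constant $\alpha_D(T)=\frac12\alpha_2(T^*T-\text{id}_d)$, where $\alpha_2(\mathcal{L})=\inf_{X>0}\mathcal{E}^2_{\mathcal{L}}(X)/\text{Ent}_2(X)$ over positive definite $X$, $\mathcal{E}^2_{\mathcal{L}}(X)=-\frac1d\text{tr}[\mathcal{L}(X)X]$, $\text{Ent}_2(X)=\frac1{2d}\text{tr}[X^2(\log\frac{X^2}{\text{tr}(X^2)}+\log d)]$. *)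

(* Defs.v *)
(* mathcomp algebra (matrices, spectral theorem) +
   real_closed complex numbers R[i] + mathcomp-analysis (powR, ln, ereal inf/sup, limits). *)
From HB Require Import structures.
From mathcomp Require Import all_boot all_order all_algebra.
From mathcomp Require Import sesquilinear spectral.
From mathcomp Require Import complex.
From mathcomp Require Import all_classical all_reals all_analysis.

Set Implicit Arguments.
Unset Strict Implicit.
Unset Printing Implicit Defensive.

Import Order.TTheory GRing.Theory Num.Theory.
Import numFieldNormedType.Exports.
Local Open Scope ring_scope.
Local Open Scope complex_scope.
Local Open Scope classical_set_scope.
Local Open Scope sesquilinear_scope.

Section QDefs.
Variable R : realType.
Local Notation C := R[i].

(* real modulus of a complex number *)
Definition cmod (z : C) : R := Num.sqrt (complex.Re z ^+ 2 + complex.Im z ^+ 2).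

(* ---------- positivity (via the sesquilinear/quadratic form) ---------- *)
(* A "matrix" indexed by an arbitrary finite type I is positive semidefinite:
   Hermitian and  <v, M v> >= 0  for every vector v (order of C: real and >= 0). *)
Definition psdf (I : finType) (M : I -> I -> C) : Prop :=
  (forall x y, M y x = (M x y)^*) /\
  (forall v : I -> C, 0 <= \sum_x \sum_y (v x)^* * M x y * v y).

Definition psdmx n (A : 'M[C]_n) : Prop := psdf (fun i j => A i j).

(* positive definite  X > 0 *)
Definition posdefmx n (A : 'M[C]_n) : Prop :=
  (forall i j, A j i = (A i j)^*) /\
  (forall v : 'I_n -> C, (exists i, v i != 0) ->
     0 < \sum_i \sum_j (v i)^* * A i j * v j).

Definition is_state n (rho : 'M[C]_n) : Prop := psdmx rho /\ \tr rho = 1.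

(* ---------- channels ---------- *)
(* completely positive: id_k (x) T is positive for every k; an element of
   M_k (x) M_n is given by its k x k array of n x n blocks B a b. *)
Definition completely_positive n (T : 'M[C]_n -> 'M[C]_n) : Prop :=
  forall (k : nat) (B : 'I_k -> 'I_k -> 'M[C]_n),
    psdf (fun x y : 'I_k * 'I_n => B x.1 y.1 x.2 y.2) ->
    psdf (fun x y : 'I_k * 'I_n => T (B x.1 y.1) x.2 y.2).

Definition trace_preserving n (T : 'M[C]_n -> 'M[C]_n) : Prop :=
  forall X, \tr (T X) = \tr X.

(* Hilbert-Schmidt adjoint T^*, characterised by tr(A^* T(B)) = tr(T^*(A)^* B):
   (T^* A)_{ij} = tr(T(E_ij)^* A). *)
Definition adjmap n (T : 'M[C]_n -> 'M[C]_n) (A : 'M[C]_n) : 'M[C]_n :=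
  \matrix_(i, j) \tr ((T (delta_mx i j)) ^t* *m A).

Definition doubly_stochastic n (T : {linear 'M[C]_n -> 'M[C]_n}) : Prop :=
  [/\ completely_positive T, trace_preserving T,
      T 1%:M = 1%:M & adjmap T 1%:M = 1%:M].

(* primitive: S^k(rho) -> 1/d for every state rho (entrywise convergence) *)
Definition primitive n (S : 'M[C]_n -> 'M[C]_n) : Prop :=
  forall rho : 'M[C]_n, is_state rho ->
    forall i j : 'I_n,
      (fun k : nat => cmod (iter k S rho i j - ((n%:R)^-1 *: (1%:M : 'M[C]_n)) i j))
        @ \oo --> (0 : R).

(* ---------- functional calculus for Hermitian matrices ---------- *)
(* f(A) = U^{-1} diag(f(lambda_i)) U, with A = U^{-1} diag(lambda) U the spectral
   decomposition (the eigenvalues of a Hermitian matrix are real). *)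
Definition mxfun (f : R -> R) n (A : 'M[C]_n) : 'M[C]_n :=
  invmx (spectralmx A) *m
  diag_mx (map_mx (fun z : C => (f (complex.Re z))%:C) (spectral_diag A)) *m
  spectralmx A.

Definition absmx n (Y : 'M[C]_n) : 'M[C]_n := mxfun Num.sqrt (Y ^t* *m Y).
Definition powmx (p : R) n (A : 'M[C]_n) : 'M[C]_n := mxfun (fun x => x `^ p) A.
Definition logmx n (A : 'M[C]_n) : 'M[C]_n := mxfun (@ln R) A.

(* weighted Schatten norm  ||Y||_{p, 1/d} = d^{-1/p} (tr |Y|^p)^{1/p} *)
Definition wnorm n (p : R) (Y : 'M[C]_n) : R :=
  (n%:R) `^ (- p^-1) * (complex.Re (\tr (powmx p (absmx Y)))) `^ (p^-1).

(* ||T||_{2 -> q, 1/d} = sup_{X <> 0} ||T X||_q / ||X||_2  (in extended reals) *)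
Definition opnorm_2q n (T : 'M[C]_n -> 'M[C]_n) (q : R) : \bar R :=
  ereal_sup [set ((wnorm q (T X) / wnorm 2 X)%:E) | X in [set X : 'M[C]_n | X != 0]].

(* ---------- log-Sobolev constants ---------- *)
(* E^2_L(X) = -(1/d) tr[L(X) X] *)
Definition energy2 n (L : 'M[C]_n -> 'M[C]_n) (X : 'M[C]_n) : R :=
  - ((n%:R)^-1 * complex.Re (\tr (L X *m X))).

(* Ent_2(X) = 1/(2d) tr[X^2 (log(X^2 / tr X^2) + log d)] *)
Definition ent2 n (X : 'M[C]_n) : R :=
  (2 * n%:R)^-1 *
  complex.Re (\tr ((X *m X) *m
     (logmx ((\tr (X *m X))^-1 *: (X *m X)) + (@ln R n%:R)%:C%:M))).

(* alpha_2(L) = inf_{X > 0} E^2_L(X) / Ent_2(X)  (over X with Ent_2(X) <> 0) *)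
Definition alpha2 n (L : 'M[C]_n -> 'M[C]_n) : \bar R :=
  ereal_inf [set ((energy2 L X / ent2 X)%:E) |
              X in [set X : 'M[C]_n | posdefmx X /\ ent2 X != 0]].

(* alpha_D(T) = 1/2 alpha_2(T^* T - id) *)
Definition alphaD n (T : 'M[C]_n -> 'M[C]_n) : \bar R :=
  (((2 : R)^-1)%:E * alpha2 (fun X => (adjmap T (T X) - X)%R))%E.

End QDefs.

(* Main.v *)
(* Set p = q/2 and let G = P^p for a positive definite P.  Expanding P in its
   eigenprojections, the scalar Jensen inequality bounds every diagonal entry of
   T(P) in an orthonormal basis, raised to the power p, by the corresponding entry
   of T(P^p), so tr T(P)^q <= tr T(G)^2.  The log-Sobolev inequality for T^*T - id
   at G gives tr T(G)^2 <= tr G^2 - (q - 2) d Ent_2(G), and an elementary inequality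
   for the eigenvalues bounds the right-hand side by d (tr P^2 / d)^p.
   For general X, complete positivity applied to [[|X^*|, X], [X^*, |X|]] >= 0
   bounds the singular values of T(X) by the means of the diagonal entries of T(|X^*|)
   and T(|X|) in the bases of left and right singular vectors of T(X).
   For q < 2 the Kadison-Schwarz inequality and monotonicity of the normalised
   Schatten norms suffice. *)
Require Import Defs.
From HB Require Import structures.
From mathcomp Require Import all_boot all_order all_algebra.
From mathcomp Require Import sesquilinear spectral.
From mathcomp Require Import complex.
From mathcomp Require Import all_classical all_reals all_analysis.
From mathcomp Require Import ring lra.
Set Implicit Arguments.
Unset Strict Implicit.
Unset Printing Implicit Defensive.

Import Order.TTheory GRing.Theory Num.Theory.
Local Open Scope ring_scope.
Local Open Scope complex_scope.
Local Open Scope sesquilinear_scope.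

(** * Scalar convexity and entropy inequalities *)

Lemma powR_tangent (R : realType) (p m x : R) : 1 <= p -> 0 <= m -> 0 <= x ->
  m `^ p + p * m `^ (p - 1) * (x - m) <= x `^ p.
Proof.
move=> p1 m0 x0; have p0 : 0 < p by lra.
have -> : p * m `^ (p - 1) * (x - m) = p * (x * m `^ (p - 1)) - p * m `^ p.
  by rewrite -(mulr_powRB1 m0 p0); ring.
(* At [p = 1] there is no finite conjugate exponent, and the claim is an equality. *)
have [->|pn1] := eqVneq p 1; first by rewrite subrr powRr0 !powRr1 //; lra.
have a0 : 0 < p - 1 by rewrite subr_gt0 lt_def pn1.
have Y := @conjugate_powR R x (m `^ (p - 1)) p (p / (p - 1)) x0 (powR_ge0 _ _) p0.
have : x * m `^ (p - 1) <=
  x `^ p / p + (m `^ (p - 1)) `^ (p / (p - 1)) / (p / (p - 1)).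
  apply: Y; first by rewrite divr_gt0.
  by field; lra.
rewrite -powRrM (_ : (p - 1) * (p / (p - 1)) = p); last by field; lra.
rewrite -(ler_pM2l p0) mulrDr [p * (_ / p)]mulrCA divff ?lt0r_neq0// mulr1.
rewrite (_ : p * (m `^ p / (p / (p - 1))) = (p - 1) * m `^ p); last by field; lra.
by lra.
Qed.

Lemma powR_jensen (R : realType) (I : finType) (k x : I -> R) (p : R) :
  1 <= p -> (forall i, 0 <= k i) -> \sum_i k i <= 1 -> (forall i, 0 <= x i) ->
  (\sum_i k i * x i) `^ p <= \sum_i k i * x i `^ p.
Proof.
move=> p1 k0 k1 x0; set m := \sum_i _.
have m0 : 0 <= m by apply: sumr_ge0 => i _; rewrite mulr_ge0.
have p0 : 0 < p by lra.
apply: (@le_trans _ _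
  (\sum_i k i * (m `^ p + p * m `^ (p - 1) * (x i - m)))); last first.
  by apply: ler_sum => i _; rewrite ler_wpM2l// powR_tangent.
have affine a b c : \sum_i k i * (a + b * (x i - c)) = (\sum_i k i) * (a - b * c) + b * m.
  rewrite mulr_suml mulr_sumr -big_split /=.
  by apply: eq_bigr => i _; ring.
rewrite affine -mulrA (mulrC _ m) mulr_powRB1//.
have Mp : 0 <= (p - 1) * m `^ p by rewrite mulr_ge0 ?powR_ge0//; lra.
have : (\sum_i k i) * ((p - 1) * m `^ p) <= 1 * ((p - 1) * m `^ p) by rewrite ler_wpM2r.
by lra.
Qed.

Lemma powR_mean (R : realType) (d : nat) (x : 'I_d -> R) (p : R) :
  (0 < d)%N -> 1 <= p -> (forall i, 0 <= x i) ->
  ((\sum_i x i) / d%:R) `^ p <= (\sum_i x i `^ p) / d%:R.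
Proof.
move=> d0 p1 x0; have dn0 : d%:R != 0 :> R by rewrite pnatr_eq0 -lt0n.
have := @powR_jensen R 'I_d (fun=> d%:R^-1) x p p1.
rewrite -!mulr_sumr ![_^-1 * _]mulrC; apply => //.
by rewrite sumr_const card_ord -[_ *+ d]mulr_natr mulVf.
Qed.

Lemma xlnx_ge (R : realType) (x y : R) : 0 < x -> 0 < y -> x - y <= x * ln (x / y).
Proof.
move=> x0 y0; have yx0 : 0 < y / x by rewrite divr_gt0.
have : ln (y / x) <= y / x - 1.
  by have := @le_ln1Dx R (y / x - 1); rewrite addrCA subrr addr0; apply; lra.
rewrite -[x / y]invf_div lnV ?posrE// -(ler_pM2l x0) mulrBr mulr1.
have -> : x * (y / x) = y by field; rewrite lt0r_neq0.
by lra.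
Qed.

(** Gibbs' inequality against the uniform distribution: the termwise lower bounds [F i - S / d] sum
    to zero. *)
Lemma relative_entropy_ge0 (R : realType) (d : nat) (F : 'I_d -> R) :
  (0 < d)%N -> (forall i, 0 < F i) ->
  0 <= \sum_i F i * (ln (F i / \sum_k F k) + ln d%:R).
Proof.
move=> d0 F0; have dn0 : 0 < d%:R :> R by rewrite ltr0n.
set S := \sum_k F k.
have S0 : 0 < S.
  rewrite /S (bigD1 (Ordinal d0))//=; apply: ltr_pwDl; first exact: F0.
  by apply: sumr_ge0 => i _; exact/ltW/F0.
apply: (@le_trans _ _ (\sum_i (F i - S / d%:R))).
  by rewrite sumrB -/S sumr_const card_ord -[_ *+ d]mulr_natr mulfVK ?lt0r_neq0 ?subrr.
apply: ler_sum => i _.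
rewrite -lnM ?posrE ?divr_gt0// -[X in ln X](_ : F i / (S / d%:R) = _).
  by rewrite xlnx_ge ?divr_gt0.
by field; rewrite !lt0r_neq0.
Qed.

(* Both inequalities are tangent-line bounds at m := (S / d)^(1/p), the common
   value of the mu i for which equality holds. *)
Lemma entropy_powR_bound (R : realType) (d : nat) (mu : 'I_d -> R) (p : R) :
  (0 < d)%N -> 1 <= p -> (forall i, 0 < mu i) ->
  \sum_i mu i `^ p - (p - 1) * (\sum_i mu i `^ p *
    (ln (mu i `^ p / \sum_k mu k `^ p) + ln d%:R)) <=
  d%:R * ((\sum_i mu i) / d%:R) `^ p.
Proof.
move=> d0 p1 mu0; have dn0 : 0 < d%:R :> R by rewrite ltr0n.
pose F i := mu i `^ p; set S := \sum_i mu i `^ p.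
have p0 : 0 < p by lra.
have F0 i : 0 < F i by rewrite powR_gt0.
have S0 : 0 < S.
  rewrite /S (bigD1 (Ordinal d0))//=; apply: ltr_pwDl; first exact: F0.
  by apply: sumr_ge0 => i _; exact/ltW/F0.
have Sd0 : 0 < S / d%:R by rewrite divr_gt0.
pose m := (S / d%:R) `^ p^-1.
have m0 : 0 < m by rewrite powR_gt0.
have mp : m `^ p = S / d%:R by rewrite -powRrM mulVf ?lt0r_neq0// powRr1// ltW.
have dS : d%:R * (S / d%:R) = S by rewrite mulrCA divff ?lt0r_neq0// mulr1.
have termwise i : p * (F i) - (p - 1) * (F i * (ln (F i / S) + ln d%:R)) <=
    p * (mu i * m `^ (p - 1)).
  have -> : ln (F i / S) + ln d%:R = p * ln (mu i / m).
    rewrite -lnM ?posrE ?divr_gt0// -ln_powR (_ : F i / S * d%:R = F i / m `^ p).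
      congr ln; rewrite /F -powR_inv1 ?powR_ge0// -powRrM -(mulrC (-1)) powRrM.
      by rewrite powR_inv1 ?ltW// -powRM ?invr_ge0 ?ltW.
    by rewrite mp; field; rewrite !lt0r_neq0.
  have r0 : 0 < mu i / m by rewrite divr_gt0.
  have -> : p * F i - (p - 1) * (F i * (p * ln (mu i / m))) =
    p * (F i * (1 - (p - 1) * ln (mu i / m))) by ring.
  rewrite ler_pM2l//.
  (* With [r = mu i / m] this is [1 + t <= exp t] at [t = - (p - 1) * ln r]. *)
  have E : (mu i / m) `^ (p - 1) * (1 - (p - 1) * ln (mu i / m)) <= 1.
    have := @expR_ge1Dx R (- ((p - 1) * ln (mu i / m))).
    rewrite expRN -ln_powR lnK ?posrE ?powR_gt0// ln_powR => E.
    by rewrite mulrC -ler_pdivlMr ?powR_gt0// div1r.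
  have -> : F i = mu i * m `^ (p - 1) * (mu i / m) `^ (p - 1).
    rewrite -mulrA -powRM ?ltW// (_ : m * (mu i / m) = mu i).
      by rewrite mulr_powRB1// ltW.
    by field; rewrite lt0r_neq0.
  have M0 : 0 < mu i * m `^ (p - 1) by rewrite mulr_gt0 ?powR_gt0.
  by rewrite -mulrA -[leRHS]mulr1 ler_pM2l.
have : \sum_i (p * F i - (p - 1) * (F i * (ln (F i / S) + ln d%:R))) <=
    \sum_i p * (mu i * m `^ (p - 1)) by apply: ler_sum => i _; exact: termwise.
rewrite sumrB -!mulr_sumr -/S -mulr_suml => E.
have M0 : 0 <= (\sum_i mu i) / d%:R.
  by apply: divr_ge0; last exact: ltW; apply: sumr_ge0 => i _; exact: ltW.
(* The tangent line based at [m] is evaluated at the mean of [mu]; the summed termwise bound [E]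
   controls its linear term. *)
have := @powR_tangent R p m _ p1 (ltW m0) M0.
rewrite -(ler_pM2l dn0); apply: le_trans.
rewrite mulrDr mp dS.
have -> : d%:R * (p * m `^ (p - 1) * ((\sum_i mu i) / d%:R - m)) =
   p * ((\sum_i mu i) * m `^ (p - 1)) - p * (d%:R * (m * m `^ (p - 1))).
  by field; rewrite lt0r_neq0.
rewrite (mulr_powRB1 (ltW m0))// mp dS; move: E; rewrite /F.
by lra.
Qed.

(** * Adjoints and the Hilbert-Schmidt norm *)

Lemma tcmx_mul (C : numClosedFieldType) m n p (A : 'M[C]_(m, n)) (B : 'M[C]_(n, p)) :
  (A *m B)^t* = B^t* *m A^t*.
Proof. by rewrite trmx_mul map_mxM. Qed.

Lemma tcmxN (C : numClosedFieldType) m n (A : 'M[C]_(m, n)) : (- A)^t* = - A^t*.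
Proof. by apply/matrixP => i j; rewrite !mxE rmorphN. Qed.

Lemma conjmx_change (C : numClosedFieldType) n (U V D : 'M[C]_n) :
  V^t* *m V = 1%:M ->
  V^t* *m ((U *m V^t*)^t* *m D *m (U *m V^t*)) *m V = U^t* *m D *m U.
Proof.
move=> VV; rewrite tcmx_mul trmxCK !mulmxA VV mul1mx.
by rewrite -!mulmxA VV mulmx1.
Qed.

Lemma mul_conjC_sq (R : realType) (z : R[i]) :
  z * Num.conj z = (complex.Re z ^+ 2 + complex.Im z ^+ 2)%:C.
Proof. by rewrite -normCK add_Re2_Im2. Qed.

(** The squared Hilbert-Schmidt norm, real-valued by construction. *)
Definition hs (R : realType) m n (A : 'M[R[i]]_(m, n)) : R :=
  \sum_i \sum_j (complex.Re (A i j) ^+ 2 + complex.Im (A i j) ^+ 2).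

Lemma hs_ge0 (R : realType) m n (A : 'M[R[i]]_(m, n)) : 0 <= hs A.
Proof. by do 2!apply: sumr_ge0 => ? _; rewrite addr_ge0 ?sqr_ge0. Qed.

Lemma mxtrace_mul_tc (R : realType) m n (A : 'M[R[i]]_(m, n)) :
  \tr (A *m A^t*) = (hs A)%:C.
Proof.
rewrite /hs rmorph_sum; apply: eq_bigr => i _; rewrite mxE rmorph_sum.
by apply: eq_bigr => j _; rewrite !mxE mul_conjC_sq.
Qed.

Lemma mxtrace_tc_mul (R : realType) m n (A : 'M[R[i]]_(m, n)) :
  \tr (A^t* *m A) = (hs A)%:C.
Proof. by rewrite mxtrace_mulC mxtrace_mul_tc. Qed.

Lemma hs_tc (R : realType) m n (A : 'M[R[i]]_(m, n)) : hs (A^t*) = hs A.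
Proof.
by apply: (@complexI R); rewrite -mxtrace_mul_tc trmxCK mxtrace_tc_mul.
Qed.

Lemma sum_diag_sqr_le_hs (R : realType) n (A : 'M[R[i]]_n) :
  \sum_j complex.Re (A j j) ^+ 2 <= hs A.
Proof.
apply: ler_sum => i _; rewrite (bigD1 i)//= -addrA lerDl addr_ge0 ?sqr_ge0//.
by apply: sumr_ge0 => j _; rewrite addr_ge0 ?sqr_ge0.
Qed.

(** Pythagoras: [W] is a partial isometry, so [Q = W^t* *m W] is an orthogonal projection and the
    gap between the two sides is [hs (A - Q *m A)]. *)
Lemma hs_isometry_le (R : realType) m n p (W : 'M[R[i]]_(m, n)) (A : 'M[R[i]]_(n, p)) :
  W *m W^t* *m W = W -> hs (W *m A) <= hs A.
Proof.
move=> WWW; rewrite -subr_ge0.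
suff -> : hs A - hs (W *m A) = hs (A - W^t* *m W *m A) by exact: hs_ge0.
apply: (@complexI R); rewrite rmorphB /= -!mxtrace_mul_tc.
have [Q QE] : exists Q, Q = W^t* *m W by exists (W^t* *m W).
rewrite -QE.
have Qt : Q^t* = Q by rewrite QE tcmx_mul trmxCK.
have QQ : Q *m Q = Q by rewrite QE mulmxA -(mulmxA (W^t*)) -(mulmxA (W^t*)) WWW.
have -> : (A - Q *m A)^t* = A^t* - A^t* *m Q.
  by rewrite linearB /= map_mxB tcmx_mul Qt.
rewrite mulmxBl !mulmxBr mulmxA.
have trB (X Y : 'M[R[i]]_n) : \tr (X - Y) = \tr X - \tr Y by exact: raddfB.
rewrite tcmx_mul !trB.
have aux (a b1 b2 b3 b4 : R[i]) : b1 = b3 -> b2 = b3 -> b4 = b3 ->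
    a - b1 = a - b2 - (b3 - b4) by move=> -> -> ->; rewrite subrr subr0.
apply: aux.
- by rewrite QE !mulmxA mxtrace_mulC !mulmxA.
- by rewrite mxtrace_mulC !mulmxA.
- by rewrite mulmxA mxtrace_mulC !mulmxA QQ.
Qed.

(** * Real diagonal matrices and functional calculus *)

Definition rdiag (R : realType) n (s : 'I_n -> R) : 'M[R[i]]_n :=
  diag_mx (\row_i (s i)%:C).

Lemma rdiag_tc (R : realType) n (s : 'I_n -> R) : (rdiag s)^t* = rdiag s.
Proof.
apply/matrixP => i j; rewrite !mxE (eq_sym i).
by case: eqVneq => [->|_]; rewrite ?mulr0n ?mulr1n ?rmorph0//; exact: conjc_real.
Qed.

Lemma rdiag_mul (R : realType) n (s t : 'I_n -> R) :
  rdiag s *m rdiag t = rdiag (fun i => s i * t i).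
Proof.
rewrite /rdiag mulmx_diag; congr diag_mx; apply/rowP => i.
by rewrite !mxE rmorphM.
Qed.

Lemma mxtrace_rdiag (R : realType) n (s : 'I_n -> R) :
  \tr (rdiag s) = (\sum_i s i)%:C.
Proof. by rewrite /rdiag mxtrace_diag rmorph_sum; apply: eq_bigr => i _; rewrite mxE. Qed.

Lemma spectral_real (R : realType) n (A : 'M[R[i]]_n) : A^t* = A ->
  A = (spectralmx A)^t* *m rdiag (fun i => complex.Re (spectral_diag A 0 i)) *m
      spectralmx A.
Proof.
move=> AH.
have hA : A \is hermsymmx by apply/is_hermitianmxP; rewrite expr0 scale1r AH.
have AE : A = (spectralmx A)^t* *m diag_mx (spectral_diag A) *m spectralmx A.
  by rewrite -(invmx_unitary (spectral_unitarymx A)); exact/orthomx_spectralP/hermitian_normalmx.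
suff <- : diag_mx (spectral_diag A) = rdiag (fun i => complex.Re (spectral_diag A 0 i)) by [].
congr diag_mx; apply/rowP => i; rewrite mxE RRe_real//.
by have /mxOverP := hermitian_spectral_diag_real hA; apply.
Qed.

(** [mxfun] uses one chosen diagonalisation; this computes it from any other. The unitary [W]
    relating the two has a nonzero entry [(i, j)] only where [s i = l j], so it also intertwines the
    images under [f]. *)
Lemma mxfun_unitary (R : realType) (f : R -> R) n (A U : 'M[R[i]]_n) (s : 'I_n -> R) :
  U \is unitarymx -> A = U^t* *m rdiag s *m U ->
  mxfun f A = U^t* *m rdiag (fun i => f (s i)) *m U.
Proof.
move=> /unitarymxP UU AE.
have UU' : U^t* *m U = 1%:M by exact/mulmx1C.
have AH : A^t* = A by rewrite AE !tcmx_mul trmxCK rdiag_tc mulmxA.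
have /unitarymxP VV := spectral_unitarymx A.
have VV' := mulmx1C VV.
rewrite /mxfun (invmx_unitary (spectral_unitarymx A)).
have AV := spectral_real AH.
set V := spectralmx A in AV VV VV' *.
set l := fun i => complex.Re (spectral_diag A 0 i) in AV.
pose W := U *m V^t*.
have sW : rdiag s *m W = W *m rdiag l.
  have E : U *m A *m V^t* = rdiag s *m W by rewrite AE /W !mulmxA UU mul1mx.
  by rewrite -E AV /W !mulmxA -(mulmxA _ V) VV mulmx1.
have fW : rdiag (fun i => f (s i)) *m W = W *m rdiag (fun i => f (l i)).
  apply/matrixP => i j; move/matrixP/(_ i j): sW.
  rewrite /rdiag !mul_diag_mx !mul_mx_diag !mxE => /eqP.
  rewrite mulrC -subr_eq0 -mulrBr mulf_eq0 => /orP[/eqP->|]; first by rewrite mulr0 mul0r.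
  by rewrite subr_eq0 => /eqP/complexI ->; rewrite mulrC.
rewrite (_ : diag_mx _ = rdiag (fun i => f (l i))); last first.
  by congr diag_mx; apply/rowP => i; rewrite !mxE.
have -> : rdiag (fun i => f (l i)) = W^t* *m rdiag (fun i => f (s i)) *m W.
  have WW : W^t* *m W = 1%:M.
    by rewrite /W tcmx_mul trmxCK -mulmxA (mulmxA (U^t*)) UU' mul1mx.
  by rewrite -mulmxA fW mulmxA WW mul1mx.
exact: conjmx_change.
Qed.

(** * Complete positivity on Gram blocks *)

Lemma rdiag_sandwichE (R : realType) m n p (A : 'M[R[i]]_(m, n)) (s : 'I_n -> R)
    (B : 'M[R[i]]_(n, p)) i j :
  (A *m rdiag s *m B) i j = \sum_k A i k * (s k)%:C * B k j.
Proof.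
by rewrite mxE; apply: eq_bigr => k _; rewrite /rdiag mul_mx_diag !mxE.
Qed.

(** Test the block form on the vector whose block [a] is the conjugate of row [j] of [W a]. *)
Lemma psdf_sandwich (R : realType) k n (B : 'I_k -> 'I_k -> 'M[R[i]]_n)
    (W : 'I_k -> 'M[R[i]]_n) j :
  psdf (fun x y : 'I_k * 'I_n => B x.1 y.1 x.2 y.2) ->
  0 <= \sum_a \sum_b (W a *m B a b *m (W b)^t*) j j.
Proof.
case=> _ /(_ (fun x => Num.conj (W x.1 j x.2))).
rewrite -(pair_bigA _ (fun a i => \sum_(y : 'I_k * 'I_n)
  Num.conj (Num.conj (W a j i)) * B a y.1 i y.2 * Num.conj (W y.1 j y.2))) /=.
congr (0 <= _); apply: eq_bigr => a _.
under eq_bigr => i _ do rewrite -(pair_bigA _ (fun b l =>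
  Num.conj (Num.conj (W a j i)) * B a b i l * Num.conj (W b j l))) /=.
rewrite exchange_big /=; apply: eq_bigr => b _.
rewrite exchange_big mxE; apply: eq_bigr => l _.
rewrite !mxE mulr_suml; apply: eq_bigr => i _.
by rewrite conjCK.
Qed.

(** Serves both semidefiniteness and definiteness: with the sum over [m] outermost, each term is
    [s m] times a squared modulus. *)
Lemma gram_form (R : realType) (I : finType) n (z : 'I_n -> I -> R[i]) (s : 'I_n -> R)
    (v : I -> R[i]) :
  \sum_x \sum_y Num.conj (v x) * (\sum_m Num.conj (z m x) * (s m)%:C * z m y) * v y =
  \sum_m (s m)%:C * ((\sum_y z m y * v y) * Num.conj (\sum_y z m y * v y)).
Proof.
transitivity (\sum_x \sum_y \sum_m (s m)%:C * (z m y * v y * Num.conj (z m x * v x))).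
  apply: eq_bigr => x _; apply: eq_bigr => y _.
  rewrite mulr_sumr mulr_suml; apply: eq_bigr => m _.
  rewrite rmorphM /=.
  have perm (a b c e f : R[i]) : a * (b * c * e) * f = c * (e * f * (b * a)) by ring.
  exact: perm.
under eq_bigr => x _ do rewrite exchange_big /=.
rewrite exchange_big /=; apply: eq_bigr => m _.
rewrite rmorph_sum mulr_sumr mulr_sumr; apply: eq_bigr => x _.
by rewrite mulr_suml mulr_sumr.
Qed.

Lemma tc_rdiag_sandwichE (R : realType) m n p (A : 'M[R[i]]_(n, m)) (s : 'I_n -> R)
    (B : 'M[R[i]]_(n, p)) i j :
  (A^t* *m rdiag s *m B) i j = \sum_k Num.conj (A k i) * (s k)%:C * B k j.
Proof. by rewrite rdiag_sandwichE; apply: eq_bigr => k _; rewrite !mxE. Qed.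

Lemma psdf_gram (R : realType) k n (Z : 'I_k -> 'M[R[i]]_n) (s : 'I_n -> R) :
  (forall m, 0 <= s m) ->
  psdf (fun x y : 'I_k * 'I_n => ((Z x.1)^t* *m rdiag s *m Z y.1) x.2 y.2).
Proof.
move=> s0; split=> [x y|v].
  have -> : (Z y.1)^t* *m rdiag s *m Z x.1 = ((Z x.1)^t* *m rdiag s *m Z y.1)^t*.
    by rewrite !tcmx_mul rdiag_tc trmxCK mulmxA.
  by rewrite [LHS]mxE [X in Num.conj X]mxE.
under eq_bigr => x _ do under eq_bigr => y _ do rewrite tc_rdiag_sandwichE.
rewrite (gram_form (fun m (x : 'I_k * 'I_n) => Z x.1 m x.2)).
apply: sumr_ge0 => m _; rewrite mulr_ge0 ?mul_conjC_ge0//.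
by rewrite lecR.
Qed.

Lemma cp_gram (R : realType) k n (T : 'M[R[i]]_n -> 'M[R[i]]_n) (Z : 'I_k -> 'M[R[i]]_n)
    (s : 'I_n -> R) :
  completely_positive T -> (forall m, 0 <= s m) ->
  psdf (fun x y : 'I_k * 'I_n => T ((Z x.1)^t* *m rdiag s *m Z y.1) x.2 y.2).
Proof.
move=> cpT s0.
exact: (cpT k (fun a b => (Z a)^t* *m rdiag s *m Z b) (psdf_gram Z s0)).
Qed.

(** The two-block case written out; suitable [X], [Y], [V], [W] give positivity, the Kadison-Schwarz
    inequality and the polar bound. *)
Lemma cp_gram2 (R : realType) n (T : 'M[R[i]]_n -> 'M[R[i]]_n) (X Y V W : 'M[R[i]]_n)
    (s : 'I_n -> R) j :
  completely_positive T -> (forall m, 0 <= s m) ->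
  0 <= (V *m T (X^t* *m rdiag s *m X) *m V^t*) j j +
       (V *m T (X^t* *m rdiag s *m Y) *m W^t*) j j +
       ((W *m T (Y^t* *m rdiag s *m X) *m V^t*) j j +
        (W *m T (Y^t* *m rdiag s *m Y) *m W^t*) j j).
Proof.
move=> cpT s0; pose Z (a : 'I_2) := if nat_of_ord a is 0%N then X else Y.
have := @psdf_sandwich R 2 n (fun a b => T ((Z a)^t* *m rdiag s *m Z b))
  (fun a => if nat_of_ord a is 0%N then V else W) j
  (cp_gram Z cpT s0).
have sum2 (F : 'I_2 -> 'I_2 -> R[i]) : \sum_a \sum_b F a b =
    F ord0 ord0 + F ord0 (lift ord0 ord0) +
    (F (lift ord0 ord0) ord0 + F (lift ord0 ord0) (lift ord0 ord0)).
  by rewrite !big_ord_recl !big_ord0 !addr0.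
by rewrite sum2.
Qed.

Lemma cp_psd (R : realType) n (T : 'M[R[i]]_n -> 'M[R[i]]_n) (X W : 'M[R[i]]_n)
    (s : 'I_n -> R) j :
  completely_positive T -> (forall m, 0 <= s m) ->
  0 <= (W *m T (X^t* *m rdiag s *m X) *m W^t*) j j.
Proof.
move=> cpT s0; have := cp_gram2 X X W 0 j cpT s0.
by rewrite trmx0 map_mx0 !mul0mx !mulmx0 !mxE !addr0.
Qed.

Lemma rdiag1 (R : realType) n : rdiag (fun _ : 'I_n => 1 : R) = 1%:M.
Proof. by apply/matrixP => i j; rewrite !mxE. Qed.

(** The Gram block matrix of [1] and [X] has [X] and its adjoint off the diagonal; hermiticity of
    its image compares their images. *)
Lemma cp_tc (R : realType) n (T : 'M[R[i]]_n -> 'M[R[i]]_n) (X : 'M[R[i]]_n) :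
  completely_positive T -> T (X^t*) = (T X)^t*.
Proof.
move=> cpT; pose Z (a : 'I_2) := if nat_of_ord a is 0%N then 1%:M else X.
have [H _] := cp_gram Z cpT (fun=> ler01).
apply/matrixP => i j; have := H (ord0, j) (lift ord0 ord0, i).
rewrite /Z /= rdiag1 !mulmx1 trmx1 map_mx1 !mul1mx => ->.
by rewrite !mxE.
Qed.

(** Take the trace of the Kadison-Schwarz inequality [T (X^t* *m X) >= (T X)^t* *m T X], using trace
    preservation on the left. *)
Lemma kadison_schwarz_hs (R : realType) n (T : {linear 'M[R[i]]_n -> 'M[R[i]]_n})
    (X : 'M[R[i]]_n) :
  completely_positive T -> trace_preserving T -> T 1%:M = 1%:M ->
  hs (T X) <= hs X.
Proof.
move=> cpT trT T1.
have H j : 0 <= (T (X^t* *m X) - (T X)^t* *m T X) j j.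
  (* This choice completes the square: one cross term cancels the last term, the other is the
     subtracted product. *)
  have := cp_gram2 X 1%:M 1%:M (- (T X)^t*) j cpT (fun=> ler01).
  rewrite rdiag1 !mulmx1 trmx1 map_mx1 !mul1mx T1 !mulmx1.
  rewrite (cp_tc _ cpT) tcmxN trmxCK.
  rewrite !mulmxN !mulNmx opprK => H; rewrite [X in 0 <= X]mxE.
  by move: H; rewrite [X in _ + (X + _)]mxE (addNr (_ : R[i])) addr0.
have : 0 <= \tr (T (X^t* *m X) - (T X)^t* *m T X) by apply: sumr_ge0.
have trB (A B : 'M[R[i]]_n) : \tr (A - B) = \tr A - \tr B by exact: raddfB.
rewrite trB trT !mxtrace_tc_mul.
by rewrite subr_ge0 lecR.
Qed.

(** * Power sums of diagonal entries for positive definite input *)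

Lemma Re_sum (R : realType) (I : finType) (F : I -> R[i]) :
  complex.Re (\sum_i F i) = \sum_i complex.Re (F i).
Proof. exact: raddf_sum. Qed.

Lemma ReCM (R : realType) (a : R) (z : R[i]) : complex.Re (a%:C * z) = a * complex.Re z.
Proof. by case: z => x y /=; rewrite mul0r subr0. Qed.

Lemma hs_diag (R : realType) n (U : 'M[R[i]]_n) (s : 'I_n -> R) :
  U \is unitarymx -> hs (U^t* *m rdiag s *m U) = \sum_i s i ^+ 2.
Proof.
move=> /unitarymxP UU; apply: (@complexI R); rewrite -mxtrace_mul_tc.
rewrite !tcmx_mul rdiag_tc trmxCK.
have -> : U^t* *m rdiag s *m U *m (U^t* *m (rdiag s *m U)) =
    U^t* *m (rdiag s *m rdiag s *m U).
  by rewrite !mulmxA -(mulmxA (U^t* *m rdiag s) U) UU mulmx1.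
rewrite mxtrace_mulC -(mulmxA _ U (U^t*)) UU mulmx1 rdiag_mul mxtrace_rdiag.
by congr (_ %:C); apply: eq_bigr => i _; rewrite expr2.
Qed.

Lemma rdiag_delta_sum (R : realType) n (s : 'I_n -> R) :
  rdiag s = \sum_i (s i)%:C *: rdiag (fun m => (m == i)%:R).
Proof.
apply/matrixP => a b; rewrite summxE (bigD1 a)//= big1 => [|i ia].
  by rewrite !mxE eqxx addr0; case: eqP => _; rewrite ?mulr0n ?mulr1n ?mulr1 ?mulr0.
by rewrite !mxE eq_sym (negbTE ia) mul0rn mulr0.
Qed.

(** The transition kernel from eigenvalues to diagonal entries: entry [j], in the frame of the rows
    of [W], of the image of the [i]-th rank-one eigenprojection. *)
Definition channel_weight (R : realType) n (T : 'M[R[i]]_n -> 'M[R[i]]_n)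
    (U W : 'M[R[i]]_n) (j i : 'I_n) : R :=
  complex.Re ((W *m T (U^t* *m rdiag (fun m => (m == i)%:R) *m U) *m W^t*) j j).

Lemma channel_weightE (R : realType) n (T : {linear 'M[R[i]]_n -> 'M[R[i]]_n})
    (U W : 'M[R[i]]_n) (s : 'I_n -> R) j :
  complex.Re ((W *m T (U^t* *m rdiag s *m U) *m W^t*) j j) =
  \sum_i channel_weight T U W j i * s i.
Proof.
rewrite rdiag_delta_sum mulmx_sumr mulmx_suml linear_sum mulmx_sumr mulmx_suml.
rewrite summxE Re_sum; apply: eq_bigr => i _.
rewrite -scalemxAr -scalemxAl linearZ /= -scalemxAr -scalemxAl mxE ReCM mulrC.
by [].
Qed.

(** The log-Sobolev inequality for [T^*T - id] at [U^t* *m rdiag g *m U], scaled by the dimension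
    and written in eigenvalues. The sum on the left is [2 * n] times the entropy, and [p] stands for
    [q / 2]. *)
Definition log_sobolev_ineq (R : realType) n (T : 'M[R[i]]_n -> 'M[R[i]]_n) (p : R) :=
  forall (U : 'M[R[i]]_n) (g : 'I_n -> R), U \is unitarymx -> (forall i, 0 < g i) ->
  (p - 1) * \sum_i g i ^+ 2 * (ln (g i ^+ 2 / \sum_k g k ^+ 2) + ln n%:R) <=
  \sum_i g i ^+ 2 - hs (T (U^t* *m rdiag g *m U)).

Lemma diag_powR_sum_le (R : realType) n (T : {linear 'M[R[i]]_n -> 'M[R[i]]_n}) (p : R)
    (U W : 'M[R[i]]_n) (l : 'I_n -> R) :
  (0 < n)%N -> 1 <= p -> completely_positive T -> T 1%:M = 1%:M ->
  log_sobolev_ineq T p ->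
  U \is unitarymx -> (forall i, 0 < l i) ->
  W *m W^t* *m W = W -> (forall j, complex.Re ((W *m W^t*) j j) <= 1) ->
  \sum_j complex.Re ((W *m T (U^t* *m rdiag l *m U) *m W^t*) j j) `^ (p * 2) <=
  n%:R * ((\sum_i l i ^+ 2) / n%:R) `^ p.
Proof.
move=> n0 p1 cpT T1 LS Uu l0 WWW W1.
pose g i := l i `^ p; pose G := U^t* *m rdiag g *m U.
have g0 i : 0 < g i by rewrite powR_gt0.
pose K := channel_weight T U W.
have K0 j i : 0 <= K j i.
  have := @cp_psd R n T U W (fun m => (m == i)%:R) j cpT (fun m => ler0n _ _).
  by rewrite lecE => /andP[].
(* Unitality of [T] turns the row sum into a diagonal entry of [W *m W^t*]. *)
have K1 j : \sum_i K j i <= 1.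
  have := channel_weightE T U W (fun=> 1) j.
  rewrite rdiag1 mulmx1 (mulmx1C (unitarymxP Uu)) T1 mulmx1.
  under [X in _ = X]eq_bigr do rewrite mulr1.
  by move=> <-; exact: W1.
apply: (@le_trans _ _ (hs (T G))); last first.
  have := LS U g Uu g0; rewrite -/G.
  have gE i : g i ^+ 2 = (l i ^+ 2) `^ p.
    by rewrite /g -(powR_mulrn 2 (powR_ge0 _ _)) -(powR_mulrn 2 (ltW (l0 i))) powRAC.
  have SE : \sum_k g k ^+ 2 = \sum_k (l k ^+ 2) `^ p by apply: eq_bigr => k _.
  rewrite SE; under eq_bigr do rewrite gE.
  have := @entropy_powR_bound R n (fun i => l i ^+ 2) p n0 p1.
  by move=> /(_ (fun i => exprn_gt0 _ (l0 i))); lra.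
(* Compressing by [W] does not increase [hs]; the right factor is treated after taking adjoints. *)
apply: (@le_trans _ _ (hs (W *m (T G *m W^t*)))); last first.
  apply: (le_trans (hs_isometry_le _ WWW)).
  rewrite -hs_tc tcmx_mul trmxCK.
  by apply: (le_trans (hs_isometry_le _ WWW)); rewrite hs_tc.
apply: le_trans (sum_diag_sqr_le_hs _); apply: ler_sum => j _.
have trans (a b c e : R) : a = b -> c = e -> b `^ (p * 2) <= e ^+ 2 ->
  a `^ (p * 2) <= c ^+ 2 by move=> -> ->.
rewrite mulmxA.
apply: (trans _ _ _ _ (channel_weightE T U W l j) (channel_weightE T U W g j)).
rewrite -/K (powRrM _ p 2).
rewrite (powR_mulrn 2 (powR_ge0 _ _)).
rewrite ler_sqr ?nnegrE ?powR_ge0//.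
  by apply: powR_jensen => // i; exact: ltW.
by apply: sumr_ge0 => i _; rewrite mulr_ge0 ?powR_ge0.
Qed.

(** * Singular values and weighted norms *)

Lemma hs_eq0 (R : realType) m n (A : 'M[R[i]]_(m, n)) : hs A = 0 -> A = 0.
Proof.
move=> A0; apply/matrixP => i j; rewrite mxE.
have F0 a b : 0 <= complex.Re (A a b) ^+ 2 + complex.Im (A a b) ^+ 2.
  by rewrite addr_ge0 ?sqr_ge0.
have S0 a : 0 <= \sum_b (complex.Re (A a b) ^+ 2 + complex.Im (A a b) ^+ 2).
  by apply: sumr_ge0 => b _; exact: F0.
have := psumr_eq0P (fun a _ => S0 a) A0 (i := i) isT.
move=> /(psumr_eq0P (fun b _ => F0 i b))/(_ j isT)/eqP.
rewrite paddr_eq0 ?sqr_ge0// !sqrf_eq0 => /andP[/eqP r0 /eqP i0].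
by apply/eqP; rewrite eq_complex r0 i0 !eqxx.
Qed.

Lemma tcmx_diag_ge0 (R : realType) m n (A : 'M[R[i]]_(m, n)) (s : 'I_m -> R) j :
  (forall k, 0 <= s k) -> 0 <= (A^t* *m rdiag s *m A) j j.
Proof.
move=> s0; rewrite mxE; apply: sumr_ge0 => k _; rewrite /rdiag mul_mx_diag !mxE.
rewrite mulrAC mulrC mulr_ge0 ?lecR// mulrC mul_conjC_ge0//.
Qed.

(** The eigenvalues are diagonal entries of the Gram matrix built from [A *m U^t*], hence
    nonnegative. *)
Lemma psd_spectral (R : realType) m n (A : 'M[R[i]]_(m, n)) (s : 'I_m -> R) :
  (forall k, 0 <= s k) ->
  exists (U : 'M[R[i]]_n) (l : 'I_n -> R), [/\ U \is unitarymx,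
    forall k, 0 <= l k & A^t* *m rdiag s *m A = U^t* *m rdiag l *m U].
Proof.
move=> s0; set B := A^t* *m rdiag s *m A.
have BH : B^t* = B by rewrite /B !tcmx_mul rdiag_tc trmxCK mulmxA.
have := spectral_real BH.
have := spectral_unitarymx B; set U := spectralmx B.
set l := fun i => complex.Re (spectral_diag B 0 i) => Uu BE.
exists U, l; split => // k; have UU := unitarymxP Uu.
have lE : rdiag l = (A *m U^t*)^t* *m rdiag s *m (A *m U^t*).
  have -> : (A *m U^t*)^t* *m rdiag s *m (A *m U^t*) = U *m B *m U^t*.
    by rewrite tcmx_mul trmxCK /B !mulmxA.
  by rewrite BE !mulmxA UU mul1mx -mulmxA UU mulmx1.
have := tcmx_diag_ge0 (A *m U^t*) k s0; rewrite -lE.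
by rewrite !mxE eqxx mulr1n lecR.
Qed.

(** Diagonalise [Y^t* *m Y] and normalise the images of its eigenvectors. Left vectors exist only
    for nonzero singular values, which avoids completing them to a basis. *)
Lemma svd (R : realType) n (Y : 'M[R[i]]_n) :
  exists (U W : 'M[R[i]]_n) (s : 'I_n -> R), [/\ U \is unitarymx, forall k, 0 <= s k,
    Y = W^t* *m rdiag s *m U, W *m W^t* = rdiag (fun k => (s k != 0)%:R)
    & W *m W^t* *m W = W].
Proof.
have [U [l [Uu l0]]] := psd_spectral Y (fun _ => ler01 : 0 <= (1 : R)).
rewrite rdiag1 mulmx1 => YY; have UU := unitarymxP Uu.
have UU' := mulmx1C UU.
pose s k := Num.sqrt (l k).
have lE k : l k = s k ^+ 2 by rewrite sqr_sqrtr.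
have UYYU : U *m Y^t* *m Y *m U^t* = rdiag l.
  have -> : U *m Y^t* *m Y *m U^t* = U *m (Y^t* *m Y) *m U^t* by rewrite !mulmxA.
  by rewrite YY !mulmxA UU mul1mx -mulmxA UU mulmx1.
(* Since 0^-1 = 0, row k of W vanishes when s k = 0: W is a partial isometry. *)
pose W := rdiag (fun k => (s k)^-1) *m U *m Y^t*.
have Wt : W^t* = Y *m U^t* *m rdiag (fun k => (s k)^-1).
  by rewrite /W !tcmx_mul trmxCK rdiag_tc mulmxA.
have WW : W *m W^t* = rdiag (fun k => (s k != 0)%:R).
  have -> : W *m W^t* = rdiag (fun k => (s k)^-1) *m (U *m Y^t* *m Y *m U^t*) *m
      rdiag (fun k => (s k)^-1) by rewrite Wt /W !mulmxA.
  rewrite UYYU !rdiag_mul; congr rdiag; apply/funext => k.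
  rewrite lE; have [->|sk] := eqVneq (s k) 0; first by rewrite invr0 !mul0r.
  by rewrite /=; field.
(* [Y] kills the eigenvectors of singular value zero, so the zero rows of [W] lose nothing when [Y]
   is rebuilt. *)
have Y0 : Y *m U^t* *m rdiag (fun k => (s k == 0)%:R) = 0.
  apply: hs_eq0; apply: (@complexI R); rewrite -mxtrace_tc_mul !tcmx_mul rdiag_tc trmxCK.
  have -> : rdiag (fun k => (s k == 0)%:R) *m (U *m Y^t*) *m
      (Y *m U^t* *m rdiag (fun k => (s k == 0)%:R)) =
      rdiag (fun k => (s k == 0)%:R) *m (U *m Y^t* *m Y *m U^t*) *m
      rdiag (fun k => (s k == 0)%:R) by rewrite !mulmxA.
  rewrite UYYU !rdiag_mul mxtrace_rdiag big1// => k _.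
  by rewrite lE; case: eqP => [->|_]; rewrite ?expr0n /= ?mulr0 ?mul0r.
exists U, W, s; split.
- exact: Uu.
- by move=> k; rewrite sqrtr_ge0.
- have idE : 1%:M = rdiag (fun k => (s k)^-1 * s k) + rdiag (fun k => (s k == 0)%:R).
    apply/matrixP => a b; rewrite !mxE; case: eqP => [->|_]; rewrite ?mulr0n ?addr0//.
    rewrite !mulr1n; case: eqP => [->|/eqP sb]; first by rewrite mulr0 add0r.
    by rewrite mulVf// addr0.
  rewrite Wt -(mulmxA (Y *m U^t*)) rdiag_mul.
  have -> : Y *m U^t* *m rdiag (fun k => (s k)^-1 * s k) = Y *m U^t*.
    by rewrite -[RHS]mulmx1 idE mulmxDr Y0 addr0.
  by rewrite -mulmxA UU' mulmx1.
- exact: WW.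
- rewrite WW /W !mulmxA rdiag_mul; congr (rdiag _ *m _ *m _); apply/funext => k.
  by case: eqP => [->|_]; rewrite ?invr0 ?mulr0 ?mul1r.
Qed.

Lemma tcmx_mul_svd (R : realType) n (U W : 'M[R[i]]_n) (s : 'I_n -> R) :
  W *m W^t* = rdiag (fun k => (s k != 0)%:R) ->
  (W^t* *m rdiag s *m U)^t* *m (W^t* *m rdiag s *m U) =
  U^t* *m rdiag (fun k => s k ^+ 2) *m U.
Proof.
move=> WW; rewrite !tcmx_mul rdiag_tc trmxCK.
have -> : U^t* *m (rdiag s *m W) *m (W^t* *m rdiag s *m U) =
   U^t* *m (rdiag s *m (W *m W^t*) *m rdiag s) *m U by rewrite !mulmxA.
have sE : (fun k => s k * (s k != 0)%:R * s k) = (fun k => s k ^+ 2).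
  by apply/funext => k; case: eqP => [->|_]; rewrite ?expr0n ?mulr0 ?mulr1 ?expr2.
by rewrite WW !rdiag_mul sE.
Qed.

Lemma hs_svd (R : realType) n (U W : 'M[R[i]]_n) (s : 'I_n -> R) :
  U \is unitarymx -> W *m W^t* = rdiag (fun k => (s k != 0)%:R) ->
  hs (W^t* *m rdiag s *m U) = \sum_k s k ^+ 2.
Proof.
move=> /unitarymxP UU WW; apply: (@complexI R).
rewrite -mxtrace_tc_mul tcmx_mul_svd// mxtrace_mulC mulmxA UU mul1mx.
exact: mxtrace_rdiag.
Qed.

(** Two uses of [mxfun_unitary], for the square root and for the power, reduce the trace to singular
    values. *)
Lemma wnorm_svd (R : realType) n (q : R) (U W : 'M[R[i]]_n) (s : 'I_n -> R) :
  U \is unitarymx -> (forall k, 0 <= s k) ->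
  W *m W^t* = rdiag (fun k => (s k != 0)%:R) ->
  wnorm q (W^t* *m rdiag s *m U) = n%:R `^ (- q^-1) * (\sum_k s k `^ q) `^ q^-1.
Proof.
move=> Uu s0 WW; have absE := mxfun_unitary Num.sqrt Uu (tcmx_mul_svd U WW).
have powE := mxfun_unitary (fun x => x `^ q) Uu absE.
rewrite /wnorm /powmx /absmx powE mxtrace_mulC mulmxA (unitarymxP Uu) mul1mx.
rewrite mxtrace_rdiag /=; congr (_ * _ `^ _).
by apply: eq_bigr => k _; rewrite sqrtr_sqr ger0_norm.
Qed.

(** * Passage to positive semidefinite input *)

Lemma le_powR_right_limit (R : realType) (x c p : R) : 0 <= c -> 0 < p ->
  (forall c', c < c' -> x <= c' `^ p) -> x <= c `^ p.
Proof.
move=> c0 p0 H; rewrite leNgt; apply/negP => xc.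
have x0 : 0 <= x by apply: le_trans (ltW xc); exact: powR_ge0.
have xp : (x `^ p^-1) `^ p = x by rewrite -powRrM mulVf ?lt0r_neq0// powRr1.
have cx : c < x `^ p^-1.
  rewrite ltNge; apply/negP => /(ge0_ler_powR (ltW p0)).
  by rewrite xp !nnegrE powR_ge0 => /(_ isT c0); rewrite leNgt xc.
have /H : c < (c + x `^ p^-1) / 2 by lra.
rewrite leNgt => /negP; apply; rewrite -[ltRHS]xp.
by apply: gt0_ltr_powR; rewrite ?nnegrE ?powR_ge0//; lra.
Qed.

(** Raising every eigenvalue by [e > 0] makes the input definite and cannot decrease the left side,
    the weights being nonnegative; only the right side needs a limit. *)
Lemma diag_powR_sum_le_ge0 (R : realType) n (T : {linear 'M[R[i]]_n -> 'M[R[i]]_n})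
    (p : R) (U W : 'M[R[i]]_n) (l : 'I_n -> R) :
  (0 < n)%N -> 1 <= p -> completely_positive T -> T 1%:M = 1%:M ->
  log_sobolev_ineq T p ->
  U \is unitarymx -> (forall i, 0 <= l i) ->
  W *m W^t* *m W = W -> (forall j, complex.Re ((W *m W^t*) j j) <= 1) ->
  \sum_j complex.Re ((W *m T (U^t* *m rdiag l *m U) *m W^t*) j j) `^ (p * 2) <=
  n%:R * ((\sum_i l i ^+ 2) / n%:R) `^ p.
Proof.
move=> n0 p1 cpT T1 LS Uu l0 WWW W1.
have nn0 : 0 < n%:R :> R by rewrite ltr0n.
set c := (\sum_i l i ^+ 2) / n%:R.
have cE : \sum_i l i ^+ 2 = c * n%:R by rewrite mulfVK ?lt0r_neq0.
have c0 : 0 <= c.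
  by apply: divr_ge0; [apply: sumr_ge0 => i _; exact: sqr_ge0 | exact: ltW].
rewrite [leRHS]mulrC -ler_pdivrMr//; apply: le_powR_right_limit => // [|c' cc']; first by lra.
rewrite ler_pdivrMr// [leRHS]mulrC.
(* From [(l i + e) ^+ 2 <= (1 + e) * l i ^+ 2 + e + e ^+ 2] and [e <= 1], the perturbed mean square
   is at most [c + e * (c + 2)], hence at most [c']. *)
pose e := Num.min 1 ((c' - c) / (c + 2)).
have e0 : 0 < e by rewrite lt_min ltr01 divr_gt0//; lra.
have e1 : e <= 1 by rewrite ge_min lexx.
have ec : e * (c + 2) <= c' - c.
  by rewrite -ler_pdivlMr ?ge_min ?lexx ?orbT//; lra.
have le0 i : 0 < l i + e by rewrite ltr_wpDl.
have := diag_powR_sum_le n0 p1 cpT T1 LS Uu le0 WWW W1.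
have K0 j i : 0 <= channel_weight T U W j i.
  have := @cp_psd R n T U W (fun m => (m == i)%:R) j cpT (fun m => ler0n _ _).
  by rewrite lecE => /andP[].
move=> H; apply: le_trans; last apply: (le_trans H).
  have trans (a b c1 c2 : R) : a = b -> c1 = c2 -> b `^ (p * 2) <= c2 `^ (p * 2) ->
    a `^ (p * 2) <= c1 `^ (p * 2) by move=> -> ->.
  apply: ler_sum => j _.
  apply: (trans _ _ _ _ (channel_weightE T U W l j)
    (channel_weightE T U W (fun i => l i + e) j)).
  apply: ge0_ler_powR; first by lra.
  - by rewrite nnegrE; apply: sumr_ge0 => i _; rewrite mulr_ge0.
  - by rewrite nnegrE; apply: sumr_ge0 => i _; rewrite mulr_ge0// ltW.
  by apply: ler_sum => i _; rewrite ler_wpM2l// lerDl ltW.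
rewrite ler_pM2l//; apply: ge0_ler_powR; rewrite ?nnegrE; first by lra.
- by apply: divr_ge0; [apply: sumr_ge0 => i _; exact: sqr_ge0 | exact: ltW].
- by lra.
rewrite ler_pdivrMr//.
apply: (@le_trans _ _ (\sum_i ((1 + e) * l i ^+ 2 + (e + e ^+ 2)))).
  apply: ler_sum => i _.
  have : 0 <= e * (l i - 1) ^+ 2 by rewrite mulr_ge0 ?sqr_ge0 ?ltW.
  by nra.
rewrite big_split /= -mulr_sumr cE sumr_const card_ord -(mulr_natr (e + e ^+ 2) n).
have -> : (1 + e) * (c * n%:R) + (e + e ^+ 2) * n%:R =
  ((1 + e) * c + (e + e ^+ 2)) * n%:R by ring.
rewrite ler_pM2r//.
by nra.
Qed.

(** * General input by polar decomposition *)

Lemma rdiag_diagE (R : realType) n (s : 'I_n -> R) j : complex.Re (rdiag s j j) = s j.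
Proof. by rewrite !mxE eqxx mulr1n. Qed.

Lemma Re_conj (R : realType) (z : R[i]) : complex.Re (Num.conj z) = complex.Re z.
Proof. by case: z. Qed.

(* The block matrix [[|X^*|, X], [X^*, |X|]] is positive semidefinite. *)
Lemma cp_polar_bound (R : realType) n (T : {linear 'M[R[i]]_n -> 'M[R[i]]_n})
    (W V W' V' : 'M[R[i]]_n) (s : 'I_n -> R) j :
  completely_positive T -> (forall k, 0 <= s k) ->
  2 * complex.Re ((W *m T (W'^t* *m rdiag s *m V') *m V^t*) j j) <=
  complex.Re ((W *m T (W'^t* *m rdiag s *m W') *m W^t*) j j) +
  complex.Re ((V *m T (V'^t* *m rdiag s *m V') *m V^t*) j j).
Proof.
move=> cpT s0; pose B := W *m T (W'^t* *m rdiag s *m V') *m V^t*.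
have E2 : (W *m T (W'^t* *m rdiag s *m V') *m (- V)^t*) j j = - B j j.
  by rewrite tcmxN mulmxN mxE.
have E3 : (- V *m T (V'^t* *m rdiag s *m W') *m W^t*) j j = - Num.conj (B j j).
  have -> : V'^t* *m rdiag s *m W' = (W'^t* *m rdiag s *m V')^t*.
    by rewrite !tcmx_mul rdiag_tc trmxCK mulmxA.
  rewrite (cp_tc _ cpT).
  have -> : - V *m (T (W'^t* *m rdiag s *m V'))^t* *m W^t* = - B^t*.
    by rewrite /B !tcmx_mul trmxCK !mulNmx mulmxA.
  by rewrite !mxE.
have E4 : (- V *m T (V'^t* *m rdiag s *m V') *m (- V)^t*) j j =
    (V *m T (V'^t* *m rdiag s *m V') *m V^t*) j j.
  by rewrite tcmxN mulmxN !mulNmx opprK.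
(* The sign on [V] moves the cross terms to the smaller side. *)
have := cp_gram2 W' V' W (- V) j cpT s0.
have subst4 (a b c e b' c' e' : R[i]) : b = b' -> c = c' -> e = e' ->
  0 <= a + b + (c + e) -> 0 <= a + b' + (c' + e') by move=> -> -> ->.
have ReP (a b e : R[i]) : 0 <= a - b + (- Num.conj b + e) ->
    2 * complex.Re b <= complex.Re a + complex.Re e.
  by rewrite lecE => /andP[_]; rewrite !raddfD !raddfN /= Re_conj; lra.
by move=> /(subst4 _ _ _ _ _ _ _ E2 E3 E4)/ReP.
Qed.

Lemma schatten_bound_ge2 (R : realType) n (T : {linear 'M[R[i]]_n -> 'M[R[i]]_n})
    (p : R) (X U W : 'M[R[i]]_n) (s : 'I_n -> R) :
  (0 < n)%N -> 1 <= p -> completely_positive T -> T 1%:M = 1%:M ->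
  log_sobolev_ineq T p ->
  U \is unitarymx -> (forall k, 0 <= s k) -> T X = W^t* *m rdiag s *m U ->
  W *m W^t* = rdiag (fun k => (s k != 0)%:R) -> W *m W^t* *m W = W ->
  \sum_k s k `^ (p * 2) <= n%:R * (hs X / n%:R) `^ p.
Proof.
move=> n0 p1 cpT T1 LS Uu s0 TXE WW WWW.
have half (x y z : R) : 2 * z <= x + y -> z <= 2^-1 * x + 2^-1 * y by lra.
have avg (x y z : R) : x <= z -> y <= z -> 2^-1 * x + 2^-1 * y <= z by lra.
have split (x y : 'I_n -> R) :
  \sum_j (2^-1 * x j + 2^-1 * y j) = 2^-1 * \sum_j x j + 2^-1 * \sum_j y j.
  by rewrite big_split !mulr_sumr.
have half0 : 0 <= 2^-1 :> R by lra.
have half1 : 2^-1 + 2^-1 <= 1 :> R by lra.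
have p21 : 1 <= p * 2 by lra.
have p20 : 0 <= p * 2 by lra.
have p0 : 0 <= p by lra.
have UU := unitarymxP Uu.
have nn0 : 0 < n%:R :> R by rewrite ltr0n.
have [V [Z [t [Vu t0 XE ZZ ZZZ]]]] := svd X.
have hsX := hs_svd Vu ZZ; rewrite -XE in hsX.
(* The matrices diagonalised here are [|X^*|], built from [Z], and [|X|], built from [V]. *)
have [V1 [l1 [V1u l10 P1E]]] := psd_spectral Z t0.
have [V2 [l2 [V2u l20 P2E]]] := psd_spectral V t0.
(* [|X^*|] is [rdiag t] compressed on both sides by the partial isometry [Z^t*], so an inequality is
   all that is needed. *)
have hs1 : \sum_i l1 i ^+ 2 <= hs X.
  rewrite -(hs_diag l1 V1u) -P1E hsX.
  have Zt : Z^t* *m (Z^t*)^t* *m Z^t* = Z^t*.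
    by rewrite trmxCK -[in RHS]ZZZ !tcmx_mul trmxCK mulmxA.
  rewrite -mulmxA; apply: (le_trans (hs_isometry_le _ Zt)).
  rewrite -hs_tc tcmx_mul rdiag_tc; apply: (le_trans (hs_isometry_le _ Zt)).
  have u1 : (1%:M : 'M[R[i]]_n) \is unitarymx.
    by apply/unitarymxP; rewrite mul1mx trmx1 map_mx1.
  have := hs_diag t u1; rewrite trmx1 map_mx1 mul1mx mulmx1 => ->.
  exact: lexx.
have hs2 : \sum_i l2 i ^+ 2 <= hs X.
  by rewrite -(hs_diag l2 V2u) -P2E hs_diag// hsX.
have W1 j : complex.Re ((W *m W^t*) j j) <= 1.
  by rewrite WW !mxE eqxx mulr1n /=; case: (s j != 0); rewrite ?lexx ?ler01.
have U1 j : complex.Re ((U *m U^t*) j j) <= 1 by rewrite UU mxE eqxx.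
have UUU : U *m U^t* *m U = U by rewrite UU mul1mx.
have mono (l : 'I_n -> R) : \sum_i l i ^+ 2 <= hs X ->
    n%:R * ((\sum_i l i ^+ 2) / n%:R) `^ p <= n%:R * (hs X / n%:R) `^ p.
  move=> lX; rewrite ler_pM2l//; apply: ge0_ler_powR; first exact: p0.
  - by rewrite nnegrE; apply: divr_ge0; [apply: sumr_ge0 => i _; exact: sqr_ge0 | exact: ltW].
  - by rewrite nnegrE; apply: divr_ge0; [exact: hs_ge0 | exact: ltW].
  - by rewrite ler_pM2r// invr_gt0.
have B1 := le_trans (diag_powR_sum_le_ge0 n0 p1 cpT T1 LS V1u l10 WWW W1) (mono l1 hs1).
have B2 := le_trans (diag_powR_sum_le_ge0 n0 p1 cpT T1 LS V2u l20 UUU U1) (mono l2 hs2).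
rewrite -P1E in B1; rewrite -P2E in B2.
set A1 := Z^t* *m rdiag t *m Z in B1; set A2 := V^t* *m rdiag t *m V in B2.
pose a j := complex.Re ((W *m T A1 *m W^t*) j j).
pose b j := complex.Re ((U *m T A2 *m U^t*) j j).
have a0 j : 0 <= a j.
  by have := cp_psd Z W j cpT t0; rewrite lecE => /andP[_].
have b0 j : 0 <= b j.
  by have := cp_psd V U j cpT t0; rewrite lecE => /andP[_].
(* Between the singular vectors of [T X], the cross term of the polar bound is exactly [s j]. *)
have sab j : s j <= 2^-1 * a j + 2^-1 * b j.
  have := cp_polar_bound W U Z V j cpT t0; rewrite -XE TXE -/A1 -/A2 -/(a j) -/(b j).
  have -> : W *m (W^t* *m rdiag s *m U) *m U^t* = rdiag s.
    rewrite -!mulmxA UU mulmx1 mulmxA WW rdiag_mul; congr rdiag; apply/funext => k.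
    by case: eqP => [->|_]; rewrite ?mulr0 ?mul1r.
  by rewrite rdiag_diagE; exact: half.
apply: (@le_trans _ _ (\sum_j (2^-1 * a j `^ (p * 2) + 2^-1 * b j `^ (p * 2)))).
  apply: ler_sum => j _.
  have := @powR_jensen R bool (fun=> 2^-1) (fun x => if x then a j else b j) (p * 2) p21.
  rewrite !big_bool /= => H; apply: le_trans (H _ _ _).
  - by apply: ge0_ler_powR; rewrite ?nnegrE ?addr_ge0 ?mulr_ge0//.
  - by move=> _; exact: half0.
  - exact: half1.
  - by case.
rewrite (split (fun j => a j `^ (p * 2)) (fun j => b j `^ (p * 2))).
exact: (avg _ _ _ B1 B2).
Qed.

(** * Log-Sobolev constants in eigenvalue form *)

(** The duality relation of [adjmap], by expanding [B^t*] in matrix units; [f] is conjugate-linear,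
    so the scalars return as entries of [B]. *)
Lemma mxtrace_adjmap (R : realType) n (T : {linear 'M[R[i]]_n -> 'M[R[i]]_n})
    (A B : 'M[R[i]]_n) :
  \tr (adjmap T A *m B) = \tr ((T (B^t*))^t* *m A).
Proof.
pose f (M : 'M[R[i]]_n) := \tr (M^t* *m A).
have fE M : f M = \sum_a \sum_b Num.conj (M b a) * A b a.
  apply: eq_bigr => a _; rewrite mxE; apply: eq_bigr => b _.
  by rewrite !mxE.
have fD : {morph f : M N / M + N >-> M + N}.
  move=> M N; rewrite !fE -big_split /=; apply: eq_bigr => a _.
  rewrite -big_split /=; apply: eq_bigr => b _.
  by rewrite mxE rmorphD mulrDl.
have f0 : f 0 = 0.
  by rewrite fE big1// => a _; rewrite big1// => b _; rewrite mxE rmorph0 mul0r.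
have fZ c M : f (c *: M) = Num.conj c * f M.
  rewrite !fE mulr_sumr; apply: eq_bigr => a _; rewrite mulr_sumr.
  by apply: eq_bigr => b _; rewrite mxE rmorphM mulrA.
rewrite -[RHS]/(f (T (B^t*))) [X in T X]matrix_sum_delta linear_sum (big_morph f fD f0).
apply: eq_bigr => i _; rewrite linear_sum (big_morph f fD f0) mxE.
apply: eq_bigr => j _; rewrite linearZ /= fZ !mxE conjCK mulrC.
by [].
Qed.

Lemma conj_unitary_posdef (R : realType) n (U : 'M[R[i]]_n) (g : 'I_n -> R) :
  U \is unitarymx -> (forall k, 0 < g k) -> posdefmx (U^t* *m rdiag g *m U).
Proof.
move=> /unitarymxP/mulmx1C UU g0; split=> [i j|v [i vi]].
  have GE : (U^t* *m rdiag g *m U)^t* = U^t* *m rdiag g *m U.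
    by rewrite !tcmx_mul rdiag_tc trmxCK mulmxA.
  by rewrite -[in LHS]GE [LHS]mxE [X in Num.conj X]mxE.
under eq_bigr => x _ do under eq_bigr => y _ do rewrite tc_rdiag_sandwichE.
rewrite (gram_form (fun m x => U m x)).
(* [U] is invertible, so [U v] has a nonzero coordinate, which makes the sum of squares strictly
   positive. *)
have [m wm] : exists m, \sum_y U m y * v y != 0.
  apply/existsP; apply: contraNT vi => /existsPn w0.
  have Uv : U *m (\col_y v y) = 0.
    apply/matrixP => m y; rewrite !mxE -[RHS](eqP (negPn (w0 m))).
    by apply: eq_bigr => z _; rewrite mxE.
  have /matrixP/(_ i 0) : \col_y v y = 0 by rewrite -[LHS]mul1mx -UU -mulmxA Uv mulmx0.
  by rewrite !mxE => ->.
rewrite (bigD1 m)//=; apply: ltr_pwDl.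
  by rewrite mulr_gt0 ?ltcR ?mul_conjC_gt0.
by apply: sumr_ge0 => k _; rewrite mulr_ge0 ?mul_conjC_ge0// lecR ltW.
Qed.

Lemma energy2_diag (R : realType) n (T : {linear 'M[R[i]]_n -> 'M[R[i]]_n})
    (U : 'M[R[i]]_n) (g : 'I_n -> R) : U \is unitarymx ->
  let G := U^t* *m rdiag g *m U in
  energy2 (fun X => adjmap T (T X) - X) G = n%:R^-1 * (\sum_k g k ^+ 2 - hs (T G)).
Proof.
move=> Uu G; have GE : G^t* = G by rewrite /G !tcmx_mul rdiag_tc trmxCK mulmxA.
have trB (A B : 'M[R[i]]_n) : \tr (A - B) = \tr A - \tr B by exact: raddfB.
rewrite /energy2 -mulrN mulmxBl trB mxtrace_adjmap GE mxtrace_tc_mul.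
have -> : \tr (G *m G) = (hs G)%:C by rewrite -mxtrace_mul_tc GE.
have ReB (a b : R) : - complex.Re (a%:C - b%:C) = b - a by rewrite -rmorphB /= opprB.
by rewrite ReB hs_diag.
Qed.

Lemma ent2_diag (R : realType) n (U : 'M[R[i]]_n) (g : 'I_n -> R) : U \is unitarymx ->
  ent2 (U^t* *m rdiag g *m U) = (2 * n%:R)^-1 *
    \sum_i g i ^+ 2 * (ln (g i ^+ 2 / \sum_k g k ^+ 2) + ln n%:R).
Proof.
move=> Uu; have UU := unitarymxP Uu; have UU' := mulmx1C UU.
have mulE a b : U^t* *m rdiag a *m U *m (U^t* *m rdiag b *m U) =
    U^t* *m rdiag (fun k => a k * b k) *m U.
  by rewrite -rdiag_mul !mulmxA -(mulmxA (U^t* *m rdiag a) U) UU mulmx1.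
have trE a : \tr (U^t* *m rdiag a *m U) = (\sum_k a k)%:C.
  by rewrite mxtrace_mulC mulmxA UU mul1mx mxtrace_rdiag.
set S := \sum_k g k ^+ 2.
have SE : \sum_k g k * g k = S by apply: eq_bigr => k _; rewrite expr2.
have scE : (S%:C)^-1 *: (U^t* *m rdiag (fun k => g k * g k) *m U) =
    U^t* *m rdiag (fun k => g k ^+ 2 / S) *m U.
  have <- : (S%:C)^-1 *: rdiag (fun k => g k * g k) = rdiag (fun k => g k ^+ 2 / S).
    apply/matrixP => a b; rewrite !mxE -fmorphV; case: eqP => _; rewrite ?mulr0n ?mulr0//.
    by rewrite !mulr1n -rmorphM mulrC expr2.
  by rewrite scalemxAl scalemxAr.
have lnE : (ln (n%:R : R))%:C%:M = U^t* *m rdiag (fun=> ln (n%:R : R)) *m U.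
  have -> : rdiag (fun _ : 'I_n => ln (n%:R : R)) = (ln (n%:R : R))%:C%:M.
    by apply/matrixP => a b; rewrite !mxE.
  by rewrite mul_mx_scalar -scalemxAl UU' scalemx1.
rewrite /ent2 mulE trE SE scE /logmx (mxfun_unitary (@ln R) Uu erefl) lnE.
rewrite -mulmxDl -mulmxDr.
have -> : rdiag (fun i => ln (g i ^+ 2 / S)) + rdiag (fun=> ln (n%:R : R)) =
    rdiag (fun i : 'I_n => ln (g i ^+ 2 / S) + ln (n%:R : R)).
  apply/matrixP => a b; rewrite !mxE; case: eqP => _; rewrite ?mulr0n ?addr0//.
  by rewrite !mulr1n rmorphD.
by rewrite mulE trE /=; congr (_ * _); apply: eq_bigr => k _; rewrite expr2.
Qed.

(** The ratio at [G] bounds the infimum, and multiplying by the positive [ent2 G] turns the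
    extended-real hypothesis into an inequality of real sums. *)
Lemma log_sobolev_of_alphaD (R : realType) n (T : {linear 'M[R[i]]_n -> 'M[R[i]]_n})
    (q : R) :
  (0 < n)%N -> completely_positive T -> trace_preserving T -> T 1%:M = 1%:M ->
  (q%:E <= 2%:E + 2%:E * alphaD T)%E -> log_sobolev_ineq T (q / 2).
Proof.
move=> n0 cpT trT T1 qa U g Uu g0; have nn0 : 0 < n%:R :> R by rewrite ltr0n.
set H := \sum_i _; pose G := U^t* *m rdiag g *m U; rewrite -/G.
have H0 : 0 <= H by apply: relative_entropy_ge0 => // i; rewrite exprn_gt0.
(* Inputs of zero entropy are outside the infimum in [alpha2]; there the claim is contractivity of
   [hs]. *)
have [HE|Hn0] := eqVneq H 0.
  by rewrite HE mulr0 subr_ge0 -(hs_diag g Uu); exact: kadison_schwarz_hs.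
have HE : 0 < H by rewrite lt_def Hn0.
have entE := ent2_diag g Uu; rewrite -/G -/H in entE.
have enE := energy2_diag T g Uu; rewrite /= -/G in enE.
have ent0 : 0 < ent2 G by rewrite entE mulr_gt0// invr_gt0 mulr_gt0.
have le_ratio : (alpha2 (fun X => (adjmap T (T X) - X)%R) <=
    (energy2 (fun X => (adjmap T (T X) - X)%R) G / ent2 G)%:E)%E.
  apply: ereal_inf_lbound; exists G => //; split; first exact: conj_unitary_posdef.
  exact: lt0r_neq0.
have : (q%:E <= (2 + energy2 (fun X => (adjmap T (T X) - X)%R) G / ent2 G)%:E)%E.
  (* The factor 2 cancels the one half in [alphaD]. *)
  apply: (le_trans qa); rewrite /alphaD muleA -EFinM divff// mul1e [leRHS]EFinD.
  exact: leeD2l.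
rewrite lee_fin -lerBlDl ler_pdivlMr// entE enE.
rewrite invfM -mulrA (mulrA (q - 2)) => h.
have : n%:R * ((q - 2) * 2^-1 * (n%:R^-1 * H)) <=
  n%:R * (n%:R^-1 * (\sum_k g k ^+ 2 - hs (T G))) by rewrite ler_pM2l.
have -> : n%:R * ((q - 2) * 2^-1 * (n%:R^-1 * H)) = (q / 2 - 1) * H.
  by field; rewrite lt0r_neq0.
by rewrite mulrA divff ?lt0r_neq0// mul1r.
Qed.

(** * Contraction of the weighted norms *)

(** Taking [q]-th roots, the normalisation of [wnorm] absorbs the factor [n]. With [c = hs X / n]
    the bound is the weighted 2-norm of [X]. *)
Lemma wnorm_le_sqrt (R : realType) n (q c : R) (U W : 'M[R[i]]_n) (s : 'I_n -> R) :
  (0 < n)%N -> 0 < q -> 0 <= c -> U \is unitarymx -> (forall k, 0 <= s k) ->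
  W *m W^t* = rdiag (fun k => (s k != 0)%:R) ->
  \sum_k s k `^ q <= n%:R * c `^ (q / 2) ->
  wnorm q (W^t* *m rdiag s *m U) <= Num.sqrt c.
Proof.
move=> n0 q0 c0 Uu s0 WW H; rewrite (wnorm_svd q Uu s0 WW).
have nn0 : 0 < n%:R :> R by rewrite ltr0n.
rewrite powRN mulrC ler_pdivrMr ?powR_gt0//.
have -> : Num.sqrt c * n%:R `^ q^-1 = (n%:R * c `^ (q / 2)) `^ q^-1.
  rewrite powRM ?powR_ge0 ?ltW// -powRrM mulrC -powR12_sqrt//; congr (_ * _ `^ _).
  by field; rewrite lt0r_neq0.
apply: ge0_ler_powR => //; rewrite ?nnegrE.
- by rewrite invr_ge0 ltW.
- by apply: sumr_ge0 => k _; exact: powR_ge0.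
- by rewrite mulr_ge0 ?powR_ge0 ?ltW.
Qed.

Lemma wnorm2E (R : realType) n (X : 'M[R[i]]_n) :
  wnorm 2 X = Num.sqrt (hs X / n%:R).
Proof.
have [U [W [s [Uu s0 XE WW _]]]] := svd X.
rewrite XE (wnorm_svd 2 Uu s0 WW) hs_svd//.
rewrite powRN !powR12_sqrt//; last by apply: sumr_ge0 => k _; exact: powR_ge0.
rewrite mulrC sqrtrM; last by apply: sumr_ge0 => k _; exact: sqr_ge0.
rewrite sqrtrV//; congr (Num.sqrt _ * _).
by apply: eq_bigr => k _; rewrite powR_mulrn.
Qed.

Theorem mainTheorem15 (R : realType) (d : nat) (T : {linear 'M[R[i]]_d -> 'M[R[i]]_d}) :
  (0 < d)%N ->
  doubly_stochastic T ->
  primitive (fun X => adjmap T (T X)) ->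
  forall q : R, 1 <= q ->
  (q%:E <= 2%:E + 2%:E * alphaD T)%E ->
  (opnorm_2q T q <= 1)%E.
Proof.
move=> d0 [cpT trT T1 _] _ q q1 qa.
have dd0 : 0 < d%:R :> R by rewrite ltr0n.
have q0 : 0 < q by exact: lt_le_trans q1.
apply: ub_ereal_sup => _ [X X0 <-]; rewrite lee_fin wnorm2E.
have hs0 : 0 < hs X.
  by rewrite lt_def hs_ge0 andbT; apply: contraNneq X0 => /hs_eq0 ->.
have c0 : 0 < hs X / d%:R by rewrite divr_gt0.
rewrite ler_pdivrMr ?sqrtr_gt0// mul1r.
have [U [W [s [Uu s0 TXE WW WWW]]]] := svd (T X).
rewrite TXE; apply: wnorm_le_sqrt => //; first exact: ltW.
have [q2|q2] := leP 2 q.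
  have p1 : 1 <= q / 2 by lra.
  have LS := log_sobolev_of_alphaD d0 cpT trT T1 qa.
  have := schatten_bound_ge2 d0 p1 cpT T1 LS Uu s0 TXE WW WWW.
  by rewrite (_ : q / 2 * 2 = q) // mulfVK.
(* For [q < 2] the power-mean inequality with exponent [2 / q] bounds the [q]-norm of [T X] by its
   2-norm, which is at most that of [X]. *)
have := @powR_mean R d (fun k => s k `^ q) (2 / q) d0.
have -> : 1 <= 2 / q by rewrite ler_pdivlMr// mul1r ltW.
move=> /(_ isT (fun k => powR_ge0 _ _)).
have sE : \sum_k (s k `^ q) `^ (2 / q) = hs (T X).
  rewrite TXE hs_svd//; apply: eq_bigr => k _.
  by rewrite -powRrM mulrCA divff ?lt0r_neq0// mulr1 powR_mulrn.
rewrite sE => H.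
have {}H : ((\sum_k s k `^ q) / d%:R) `^ (2 / q) <= hs X / d%:R.
  by apply: (le_trans H); rewrite ler_pM2r ?invr_gt0//; exact: kadison_schwarz_hs.
rewrite mulrC -ler_pdivrMr//.
have m0 : 0 <= (\sum_k s k `^ q) / d%:R.
  by apply: divr_ge0; [apply: sumr_ge0 => k _; exact: powR_ge0 | exact: ltW].
have -> : (\sum_k s k `^ q) / d%:R = (((\sum_k s k `^ q) / d%:R) `^ (2 / q)) `^ (q / 2).
  rewrite -powRrM (_ : 2 / q * (q / 2) = 1) ?powRr1//.
  by field; rewrite lt0r_neq0.
apply: ge0_ler_powR; rewrite ?nnegrE ?powR_ge0//.
- by rewrite divr_ge0// ltW.
- exact: ltW.
Qed.
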